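(* Let $f\in\mathbb{Q}[x_1,\dots,x_n]$ be a SONC PN-polynomial of degree $d\ge2$ with $t$ terms, such that $\tilde{\mathscr{A}}=\varnothing$ and $f$ lies in the interior of the SONC cone. Let $(u_i^k,v_i^k,w_i^k)$, $1\le i\le s_k$, $1\le k\le l$, be the triples of the program (SONC-SOCP) associated with $f$, and let $L=\sum_{k=1}^ls_k$ be their total number. Then $$L<\tfrac18\,t\,n\,\big((n+1)\log_2(1+nd^2)+3\big)^2\in\widetilde{\mathcal{O}}(d^nn^3).$$
   Context: $\mathbb{N}=\{0,1,2,\dots\}$. $g\in\widetilde{\mathcal{O}}(h)$ means that there is $c\in\mathbb{N}$ with $g\le h\log_2(h)^c$ for all parameter values. SONC. For $f=\sum_\alpha f_\alpha\mathbf{x}^\alpha$, $\Lambda(f)=\{\alpha\in\mathrm{supp}(f)\cap(2\mathbb{N})^n\mid f_\alpha>0\}$, $\Gamma(f)=\mathrm{supp}(f)\setminus\Lambda(f)$; write $f=\sum_{\alpha\in\Lambda(f)}c_\alpha\mathbf{x}^\alpha-\sum_{\beta\in\Gamma(f)}d_\beta\mathbf{x}^\beta$. $f$ is a PN-polynomial if $d_\beta>0$ for all $\beta\in\Gamma(f)$. A circuit is a pair $(T,\beta)$ with $T\subseteq(2\mathbb{N})^n$ the vertex set of a simplex and $\beta\in\mathbb{N}^n$ in the relative interior of $\mathrm{conv}(T)$. A circuit polynomial is $\sum_{\alpha\in T}c_\alpha\mathbf{x}^\alpha-d\mathbf{x}^\beta$ with $(T,\beta)$ a circuit, $c_\alpha>0$,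 $d\in\mathbb{R}$; a SONC polynomial is a finite sum of circuit polynomials nonnegative on $\mathbb{R}^n$ and monomial squares $c\mathbf{x}^\alpha$ ($c\ge0$, $\alpha\in(2\mathbb{N})^n$). The SONC cone is the convex cone of SONC polynomials with given support. $\mathscr{C}(\beta)$ is the set of $T\subseteq\Lambda(f)$ such that $(T,\beta)$ is a circuit, and $\tilde{\mathscr{A}}$ is the set of $\alpha\in\Lambda(f)$ lying in no $T\in\mathscr{C}(\beta)$, $\beta\in\Gamma(f)$. Triples of (SONC-SOCP). They are obtained in two steps. (1) SimplexCover$(\Lambda(f),\Gamma(f))$ returns circuits $(T_k,\beta_k)$, $k=1,\dots,l$. Set $U=\Lambda(f)$, $V=\Gamma(f)$. A step chooses $\alpha_0\in U$, $\beta_k\in V$ (with $\alpha_0$ on the same face of the Newton polytope if $\beta_k$ lies on a face), takes a (vertex) solution $\lambda$ of the linear program $\max\lambda_{\alpha_0}$ subject to $\sum_{\alpha\in\Lambda(f)}\lambda_\alpha\alpha=\beta_k$, $\sum_{\alpha\in\Lambda(f)}\lambda_\alpha=1$, $\lambda\ge0$, sets $T_k=\{\alpha\mid\lambda_\alpha>0\}$ (the vertex set of a simplex), and replaces $U$ by $U\setminus T_k$ and $V$ by $V\setminus\{\beta_k\}$. Steps are done while $U,V\ne\varnothing$. If then $V\neq\varnothing$, steps continue until $V=\varnothing$, resetting $U:=\Lambda(f)$ whenever $U=\varnothing$; otherwise steps continue until $U=\varnothing$, resetting $V:=\Gamma(f)$ whenever $V=\varnothing$. (2) For each $k$, $\{(u_i^k,v_i^k,w_i^k)\}_{i=1}^{s_k}=$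 MedSet$(T_k,\beta_k)$, with $u_i^k=\frac12(v_i^k+w_i^k)$. For $T=\{\alpha_1,\dots,\alpha_m\}$, write $\beta=\sum_{i=1}^m\frac{q_i}{p}\alpha_i$ with $p=\sum q_i$, $q_i$ positive integers, $\gcd(p,q_1,\dots,q_m)=1$; put $\beta_0=\beta$ and $\beta_j=\sum_{i=j+1}^m\frac{q_i}{p-(q_1+\dots+q_j)}\alpha_i$ for $1\le j\le m-2$. MedSet$(T,\beta)$ is the union of LMedSet$(\alpha_j,\beta_j,\beta_{j-1})$ for $1\le j\le m-2$ and LMedSet$(\alpha_{m-1},\alpha_m,\beta_{m-2})$. For $\beta'=(1-\frac qp)\alpha'+\frac qp\alpha''$ with integers $0<q<p$, $\gcd(p,q)=1$, LMedSet$(\alpha',\alpha'',\beta')$ is the image of MedSeq$(p,q)$ under $s\mapsto(1-\frac sp)\alpha'+\frac sp\alpha''$ applied to each entry of each triple. MedSeq$(p,q)$, $0<q<p$, is a set of integer triples $(u,v,w)$, $u=\frac12(v+w)$, defined recursively: let $g=\gcd(p,q)$, $a=p/g$, $b=q/g$, and return $g$ times the set $S$, where - $a$ even: $S=\{(1,0,2)\}$ if $b=a/2$; $S=\text{MedSeq}(\frac a2,b)\cup\{(\frac a2,0,a)\}$ if $b<\frac a2$; $S=\{(\frac a2,0,a)\}\cup(\text{MedSeq}(\frac a2,b-\frac a2)+\frac a2)$ if $b>\frac a2$; - $a$ odd, $b=2^jr$ even with $r$ odd: let $E=\{((1-2^{-i})b,(1-2^{-(i-1)})b,b)\mid1\le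 i\le j\}$; $S=E\cup\{(b,b-r,a)\}$ if $b=a-r$; $S=E\cup\{(\frac{b-r+a}2,b-r,a)\}\cup(\text{MedSeq}(\frac{a+r-b}2,r)+b-r)$ if $b<a-r$; $S=E\cup\{(\frac{b-r+a}2,b-r,a)\}\cup(\text{MedSeq}(\frac{a+r-b}2,\frac{b+r-a}2)+\frac{a+b-r}2)$ if $b>a-r$; - $a,b$ odd: $S=a-\text{MedSeq}(a,a-b)$. (SONC-SOCP) is the problem of maximizing $\xi$ subject to $f-\xi=\sum_{k=1}^l\sum_{i=1}^{s_k}(2a_i^k\mathbf{x}^{v_i^k}+b_i^k\mathbf{x}^{w_i^k}-2c_i^k\mathbf{x}^{u_i^k})$, $(a_i^k,b_i^k,c_i^k)\in\mathbf{K}=\{(a,b,c)\in\mathbb{R}^3\mid2ab\ge c^2,a\ge0,b\ge0\}$, so $L$ is the number of second-order cones used.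
   Formalization: The soft-O inequality without a constant fails at n=1, d=2 (there h=d^n n^3=2 and log2(h)=1, e.g. f=x^2-x+1); the formal version proves it literally whenever h>2 and, for all parameter values, with a uniform constant factor C. *)

(* Defs.v *)
(* MathComp with MathComp-Analysis; polynomials and exponent vectors are
   {mpoly R[n]} and 'X_{1..n} from multinomials. *)
From HB Require Import structures.
From mathcomp Require Import all_boot all_order all_algebra finmap.
From mathcomp Require Import mpoly.
From mathcomp Require Import boolp classical_sets reals topology normedtype exp.
From mathcomp Require Import zify.

Set Implicit Arguments.
Unset Strict Implicit.
Unset Printing Implicit Defensive.

Import Order.TTheory GRing.Theory Num.Theory.
Import numFieldNormedType.Exports.

Local Open Scope classical_set_scope.
Local Open Scope ring_scope.

Definition log2 (R : realType) (x : R) : R := ln x / ln 2.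

(* g \in O~(h) over the parameter values satisfying D: there is a single
   exponent c with g <= h * log2(h)^c.  Where h <= 2 one has log2(h) <= 1, so
   that log2(h)^c absorbs no constant; there, and only there, a constant factor
   C, uniform in the parameters, is allowed. *)
Definition softO (R : realType) (P : Type) (D : P -> Prop) (g h : P -> R) :
    Prop :=
  exists c C : nat, forall x : P, D x ->
    (2 < h x -> g x <= h x * log2 (h x) ^+ c) /\
    g x <= C%:R * h x * log2 (h x) ^+ c.

Definition conv_hull (R : realType) (n : nat) (A : set 'rV[R]_n) :
    set 'rV[R]_n :=
  [set x | exists s : seq (R * 'rV[R]_n),
    [/\ forall e, e \in s -> 0 <= e.1 /\ A e.2,
        \sum_(e <- s) e.1 = 1 &
        x = \sum_(e <- s) e.1 *: e.2]].

Definition aff_hull (R : realType) (n : nat) (A : set 'rV[R]_n) :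
    set 'rV[R]_n :=
  [set x | exists s : seq (R * 'rV[R]_n),
    [/\ forall e, e \in s -> A e.2,
        \sum_(e <- s) e.1 = 1 &
        x = \sum_(e <- s) e.1 *: e.2]].

Definition relint (R : realType) (n : nat) (A : set 'rV[R]_n) :
    set 'rV[R]_n :=
  [set x | A x /\ \forall y \near x, aff_hull A y -> A y].

(* P itself counts as a face. *)
Definition face (R : realType) (n : nat) (P F : set 'rV[R]_n) : Prop :=
  [/\ F `<=` P,
      forall x y (t : R), F x -> F y -> 0 <= t <= 1 ->
        F ((1 - t) *: x + t *: y) &
      forall x y (t : R), P x -> P y -> 0 < t < 1 ->
        F ((1 - t) *: x + t *: y) -> F x /\ F y].

Definition evec (R : nzRingType) (n : nat) (m : 'X_{1..n}) : 'rV[R]_n :=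
  \row_i (m i)%:R.

Definition even_mnm (n : nat) (m : 'X_{1..n}) : bool :=
  [forall i, ~~ odd (m i)].

Definition points (R : realType) (n : nat) (T : {fset 'X_{1..n}}) :
    set 'rV[R]_n :=
  [set evec R a | a in [set` T]].

Definition newton (R : realType) (n : nat) (f : {mpoly R[n]}) :
    set 'rV[R]_n :=
  conv_hull [set evec R a | a in [set` msupp f]].

Definition aff_indep (R : realType) (n : nat) (T : {fset 'X_{1..n}}) : Prop :=
  forall mu : 'X_{1..n} -> R,
    \sum_(a <- T) mu a = 0 -> \sum_(a <- T) mu a *: evec R a = 0 ->
    forall a, a \in T -> mu a = 0.

Definition circuit (R : realType) (n : nat) (T : {fset 'X_{1..n}})
    (b : 'X_{1..n}) : Prop :=
  [/\ forall a, a \in T -> even_mnm a,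
      aff_indep R T &
      relint (conv_hull (@points R n T)) (evec R b)].

Definition circuit_poly (R : realType) (n : nat) (g : {mpoly R[n]}) : Prop :=
  exists (T : {fset 'X_{1..n}}) (b : 'X_{1..n}) (c : 'X_{1..n} -> R) (d : R),
    [/\ circuit R T b,
        forall a, a \in T -> 0 < c a &
        g = \sum_(a <- T) c a *: 'X_[a] - d *: 'X_[b]].

Definition nonneg_poly (R : realType) (n : nat) (g : {mpoly R[n]}) : Prop :=
  forall x : 'I_n -> R, 0 <= g.@[x].

Definition monomial_square (R : realType) (n : nat) (g : {mpoly R[n]}) : Prop :=
  exists (c : R) (a : 'X_{1..n}),
    [/\ 0 <= c, even_mnm a & g = c *: 'X_[a]].

Definition sonc (R : realType) (n : nat) (f : {mpoly R[n]}) : Prop :=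
  exists s : seq {mpoly R[n]},
    (forall g, g \in s ->
       (circuit_poly g /\ nonneg_poly g) \/ monomial_square g) /\
    f = \sum_(g <- s) g.

(* The cone of SONC polynomials supported in A, in the coordinates R^A. *)
Definition sonc_cone (R : realType) (n : nat) (A : seq 'X_{1..n}) :
    set 'rV[R]_(size A) :=
  [set c | sonc (\sum_(i < size A) c 0 i *: 'X_[R, tnth (in_tuple A) i])].

Definition coef_row (R : realType) (n : nat) (A : seq 'X_{1..n})
    (f : {mpoly R[n]}) : 'rV[R]_(size A) :=
  \row_i f@_(tnth (in_tuple A) i).

Definition in_sonc_interior (R : realType) (n : nat) (f : {mpoly R[n]}) : Prop :=
  interior (@sonc_cone R n (msupp f)) (coef_row (msupp f) f).

Definition Lam (R : realType) (n : nat) (f : {mpoly R[n]}) :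
    {fset 'X_{1..n}} :=
  [fset a in msupp f | even_mnm a && (0 < f@_a)]%fset.

Definition Gam (R : realType) (n : nat) (f : {mpoly R[n]}) :
    {fset 'X_{1..n}} :=
  [fset b in msupp f | b \notin Lam f]%fset.

(* d_b = - f_b for b in Gam f. *)
Definition pn_poly (R : realType) (n : nat) (f : {mpoly R[n]}) : Prop :=
  forall b, b \in Gam f -> 0 < - f@_b.

Definition Circ (R : realType) (n : nat) (f : {mpoly R[n]}) (b : 'X_{1..n}) :
    set {fset 'X_{1..n}} :=
  [set T | {subset T <= Lam f} /\ circuit R T b].

Definition Atilde (R : realType) (n : nat) (f : {mpoly R[n]}) :
    set 'X_{1..n} :=
  [set a | a \in Lam f /\
     forall b T, b \in Gam f -> Circ f b T -> a \notin T].

(* Only the values of la on Lam f matter. *)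
Definition lp_feasible (R : realType) (n : nat) (f : {mpoly R[n]})
    (b : 'X_{1..n}) (la : 'X_{1..n} -> R) : Prop :=
  [/\ \sum_(a <- Lam f) la a *: evec R a = evec R b,
      \sum_(a <- Lam f) la a = 1 &
      forall a, a \in Lam f -> 0 <= la a].

Definition lp_vertex (R : realType) (n : nat) (f : {mpoly R[n]})
    (b : 'X_{1..n}) (la : 'X_{1..n} -> R) : Prop :=
  lp_feasible f b la /\
  forall mu nu, lp_feasible f b mu -> lp_feasible f b nu ->
    (forall a, a \in Lam f -> la a = (mu a + nu a) / 2) ->
    forall a, a \in Lam f -> mu a = nu a.

Definition lp_vertex_solution (R : realType) (n : nat) (f : {mpoly R[n]})
    (b a0 : 'X_{1..n}) (la : 'X_{1..n} -> R) : Prop :=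
  lp_vertex f b la /\ forall mu, lp_feasible f b mu -> mu a0 <= la a0.

(* a0 has to lie on every face of the Newton polytope containing b, i.e. on the
   smallest such face. *)
Definition cover_step (R : realType) (n : nat) (f : {mpoly R[n]})
    (U V : {fset 'X_{1..n}}) (T : {fset 'X_{1..n}}) (b : 'X_{1..n}) : Prop :=
  b \in V /\
  exists2 a0, a0 \in U &
    (forall F, face (newton f) F -> F (evec R b) -> F (evec R a0)) /\
    exists2 la, lp_vertex_solution f b a0 la &
      T = [fset a in Lam f | 0 < la a]%fset.

(* cover_V f U V cs : from the state (U, V), the loop running until V is empty
   can output cs; cover_U is the loop running until U is empty, and cover_main
   the whole procedure started from (U, V).  The choices made at each step are
   arbitrary; a run left without an admissible choice outputs nothing. *)
Inductive cover_V (R : realType) (n : nat) (f : {mpoly R[n]}) :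
    {fset 'X_{1..n}} -> {fset 'X_{1..n}} ->
    seq ({fset 'X_{1..n}} * 'X_{1..n}) -> Prop :=
| cover_V_done U : cover_V f U fset0 [::]
| cover_V_step U V T b cs :
    V != fset0 ->
    let U' := if U == fset0 then Lam f else U in
    cover_step f U' V T b ->
    cover_V f (U' `\` T)%fset (V `\ b)%fset cs ->
    cover_V f U V ((T, b) :: cs).

Inductive cover_U (R : realType) (n : nat) (f : {mpoly R[n]}) :
    {fset 'X_{1..n}} -> {fset 'X_{1..n}} ->
    seq ({fset 'X_{1..n}} * 'X_{1..n}) -> Prop :=
| cover_U_done V : cover_U f fset0 V [::]
| cover_U_step U V T b cs :
    U != fset0 ->
    let V' := if V == fset0 then Gam f else V in
    cover_step f U V' T b ->
    cover_U f (U `\` T)%fset (V' `\ b)%fset cs ->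
    cover_U f U V ((T, b) :: cs).

Inductive cover_main (R : realType) (n : nat) (f : {mpoly R[n]}) :
    {fset 'X_{1..n}} -> {fset 'X_{1..n}} ->
    seq ({fset 'X_{1..n}} * 'X_{1..n}) -> Prop :=
| cover_main_step U V T b cs :
    U != fset0 -> V != fset0 ->
    cover_step f U V T b ->
    cover_main f (U `\` T)%fset (V `\ b)%fset cs ->
    cover_main f U V ((T, b) :: cs)
| cover_main_V V cs :
    V != fset0 -> cover_V f fset0 V cs -> cover_main f fset0 V cs
| cover_main_U U cs :
    cover_U f U fset0 cs -> cover_main f U fset0 cs.

Definition simplex_cover (R : realType) (n : nat) (f : {mpoly R[n]})
    (cs : seq ({fset 'X_{1..n}} * 'X_{1..n})) : Prop :=
  cover_main f (Lam f) (Gam f) cs.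

Definition map3 (X Y : Type) (h : X -> Y) (t : X * X * X) : Y * Y * Y :=
  (h t.1.1, h t.1.2, h t.2).

Definition map_triples (X Y : choiceType) (h : X -> Y)
    (S : {fset X * X * X}) : {fset Y * Y * Y} :=
  [fset map3 h t | t in S]%fset.

Definition medseq_body (rec : nat -> nat -> {fset int * int * int})
    (p q : nat) : {fset int * int * int} :=
  let g := gcdn p q in
  let a := (p %/ g)%N in
  let b := (q %/ g)%N in
  let S :=
    if ~~ odd a then
      let h := (a %/ 2)%N in
      if b == h then [fset (1%:Z, 0%:Z, 2%:Z)]%fset
      else if (b < h)%N then
        (rec h b `|` [fset (h%:Z, 0%:Z, a%:Z)])%fset
      else
        ([fset (h%:Z, 0%:Z, a%:Z)] `|`
         map_triples (fun s : int => (s + h%:Z)%R) (rec h (b - h)%N))%fset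
    else if ~~ odd b then
      let j := logn 2 b in
      let r := (b %/ 2 ^ j)%N in
      let E := [fset ((b - b %/ 2 ^ i)%N%:Z, (b - b %/ 2 ^ i.-1)%N%:Z, b%:Z)
                 | i in iota 1 j]%fset in
      if b == (a - r)%N then
        (E `|` [fset (b%:Z, (b - r)%N%:Z, a%:Z)])%fset
      else
        let e := (((b - r + a) %/ 2)%N%:Z, (b - r)%N%:Z, a%:Z) in
        if (b < a - r)%N then
          (E `|` [fset e] `|`
           map_triples (fun s : int => (s + (b - r)%N%:Z)%R)
             (rec ((a + r - b) %/ 2)%N r))%fset
        else
          (E `|` [fset e] `|`
           map_triples (fun s : int => (s + ((a + b - r) %/ 2)%N%:Z)%R)
             (rec ((a + r - b) %/ 2)%N ((b + r - a) %/ 2)%N))%fset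
    else map_triples (fun s : int => a%:Z - s) (rec a (a - b)%N) in
  map_triples (fun s : int => g%:Z * s) S.

(* The recursive calls need not decrease p (odd/odd case), but two successive
   ones do; fuel 2p thus suffices, as medseqE shows. *)
Fixpoint medseq_fuel (k : nat) (p q : nat) : {fset int * int * int} :=
  if k is k'.+1 then medseq_body (medseq_fuel k') p q else fset0.

Definition medseq (p q : nat) : {fset int * int * int} :=
  medseq_fuel (2 * p) p q.

Lemma medseq_body_ext (rec1 rec2 : nat -> nat -> {fset int * int * int})
    (p q : nat) : (0 < q < p)%N ->
  (forall p' q', (0 < q' < p')%N ->
     (p' < p)%N \/ [/\ odd p, odd q, p' = p & ~~ odd q'] ->
     rec1 p' q' = rec2 p' q') ->
  medseq_body rec1 p q = medseq_body rec2 p q.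
Proof.
move=> pq H; rewrite /medseq_body.
set g := gcdn p q; set a := (p %/ g)%N; set b := (q %/ g)%N.
have g0 : (0 < g)%N by rewrite gcdn_gt0; lia.
have pE : p = (a * g)%N by rewrite divnK // dvdn_gcdl.
have qE : q = (b * g)%N by rewrite divnK // dvdn_gcdr.
have [b0 ab] : (0 < b)%N /\ (b < a)%N by nia.
have ap : (a <= p)%N by nia.
have gp : (a < p)%N \/ (a = p /\ b = q) by nia.
congr map_triples; case: ifPn => [ea|/negPn oa].
  have aE : a = (2 * (a %/ 2))%N by lia.
  case: ifPn => // bh; case: ifPn => bh'; congr (_ `|` _)%fset.
    by apply: H; lia.
  by congr map_triples; apply: H; lia.
case: ifPn => [eb|/negPn ob].
  set r := (b %/ 2 ^ logn 2 b)%N.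
  have bE : b = (r * 2 ^ logn 2 b)%N by rewrite divnK // pfactor_dvdnn.
  have j0 : (0 < logn 2 b)%N by rewrite logn_gt0 mem_primes /= b0 dvdn2.
  have [j jE] : exists j, logn 2 b = j.+1 by exists (logn 2 b).-1; lia.
  have r0 : (0 < r)%N by nia.
  have rb : (2 * r <= b)%N.
    rewrite bE jE expnS; have := expn_gt0 2 j; nia.
  have or : odd r.
    have := @pfactor_coprime 2 b isT b0 => -[r' cr' br'].
    suff -> : r = r' by rewrite coprime2n in cr'.
    by rewrite /r {1}br' mulnK // expn_gt0.
  case: eqP => // bar; case: ifPn => bar'; congr (_ `|` _)%fset;
    congr map_triples; (apply: H; [lia | left; lia]).
congr map_triples; apply: H; first by lia.
case: gp => [ap'|[aE bE]]; [left; lia | right; split; lia].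
Qed.

Lemma medseq_fuel_stable (k1 k2 p q : nat) : (0 < q < p)%N ->
  (2 * p - ~~ (odd p && odd q) <= k1)%N ->
  (2 * p - ~~ (odd p && odd q) <= k2)%N ->
  medseq_fuel k1 p q = medseq_fuel k2 p q.
Proof.
elim: k1 k2 p q => [|k1 IH] [|k2] p q pq h1 h2.
- by have := leq_b1 (~~ (odd p && odd q)); lia.
- by have := leq_b1 (~~ (odd p && odd q)); lia.
- by have := leq_b1 (~~ (odd p && odd q)); lia.
apply: medseq_body_ext => // p' q' pq' [lt|[op oq pE eq']].
  have hb := leq_b1 (~~ (odd p && odd q)); apply: IH => //; lia.
by rewrite op oq /= in h1 h2; apply: IH; rewrite // pE (negbTE eq') andbF /=; lia.
Qed.

Lemma medseqE (p q : nat) : (0 < q < p)%N ->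
  medseq p q = medseq_body medseq p q.
Proof.
move=> pq; rewrite {1}/medseq; case: (posnP p) => [|p0]; first lia.
have -> : (2 * p)%N = (2 * p).-1.+1 by lia.
rewrite /=; apply: medseq_body_ext => // p' q' pq' H.
by apply: medseq_fuel_stable => //; case: H => [|[]]; lia.
Qed.

Definition lmedset (n : nat) (a' a'' b : 'rV[rat]_n)
    (S : {fset 'rV[rat]_n * 'rV[rat]_n * 'rV[rat]_n}) : Prop :=
  exists p q : nat,
    [/\ (0 < q < p)%N, coprime p q,
        b = (1 - q%:R / p%:R) *: a' + (q%:R / p%:R) *: a'' &
        S = map_triples
              (fun s : int => (1 - s%:~R / p%:R) *: a' + (s%:~R / p%:R) *: a'')
              (medseq p q)].

(* The enumeration ts of T is arbitrary.  Indices start at 0: al i is alpha_(i+1)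
   and q_i is q_(i+1), while be j is beta_j, be 0 being beta. *)
Definition medset (n : nat) (T : {fset 'X_{1..n}}) (b : 'X_{1..n})
    (S : {fset 'rV[rat]_n * 'rV[rat]_n * 'rV[rat]_n}) : Prop :=
  exists (ts : seq 'X_{1..n}) (q : seq nat)
         (Ss : nat -> {fset 'rV[rat]_n * 'rV[rat]_n * 'rV[rat]_n}),
    let m := size ts in
    let p := sumn q in
    let al i := evec rat (nth 0%MM ts i) in
    let be j := \sum_(j <= i < m)
      ((nth 0%N q i)%:R / (p - \sum_(0 <= l < j) nth 0%N q l)%N%:R) *: al i in
    [/\ [/\ uniq ts, ts =i T & (1 < m)%N],
        [/\ size q = m, all (fun x => 0 < x)%N q,
            foldr gcdn p q = 1%N & evec rat b = be 0%N],
        forall j, (j < m - 2)%N -> lmedset (al j) (be j.+1) (be j) (Ss j),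
        lmedset (al (m - 2)%N) (al (m - 1)%N) (be (m - 2)%N) (Ss (m - 2)%N) &
        S = \big[fsetU/fset0]_(j < m.-1) Ss j].

(* Ss lists, circuit by circuit, the sets of triples {(u_i^k, v_i^k, w_i^k)}_i
   of a program (SONC-SOCP) for f; their number depends on the choices made. *)
Definition socp_triples (R : realType) (n : nat) (f : {mpoly R[n]})
    (Ss : seq {fset 'rV[rat]_n * 'rV[rat]_n * 'rV[rat]_n}) : Prop :=
  exists2 cs, simplex_cover f cs &
    size Ss = size cs /\
    forall k, (k < size cs)%N ->
      medset (nth (fset0, 0%MM) cs k).1 (nth (fset0, 0%MM) cs k).2
             (nth fset0 Ss k).

Definition sonc_instance (R : realType) (n d t : nat) (f : {mpoly rat[n]}) :
    Prop :=
  let F := map_mpoly (@ratr R) f in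
  [/\ [/\ (msize f).-1 = d, (2 <= d)%N & size (msupp f) = t],
      pn_poly F, sonc F, Atilde F = set0 & in_sonc_interior F].

(* Main.v *)
Require Import Defs.
From HB Require Import structures.
From mathcomp Require Import all_boot all_order all_algebra finmap.
From mathcomp Require Import mpoly.
From mathcomp Require Import boolp classical_sets reals topology normedtype exp.
From mathcomp Require Import perm zify lra.

Set Implicit Arguments.
Unset Strict Implicit.
Unset Printing Implicit Defensive.

Import Order.TTheory GRing.Theory Num.Theory.
Import numFieldNormedType.Exports.

Local Open Scope ring_scope.

(** Every circuit of the cover contributes at most [n] sets of the form
[medseq p q], so the estimate is the product of three bounds.

- There are at most [t] circuits.  A step of the cover removes its exponent
  [b] from [V], which bounds the steps charged to [Gam f].  In the last loop,
  where [V] is refilled, progress has to come from [U]: the chosen [a0] always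
  gets a positive weight, hence leaves [U] ([optimal_weight_gt0]).  Indeed [a0]
  lies on the minimal face of the Newton polytope containing [b], so that [b]
  is strictly between [a0] and another point of the polytope; and by the time
  this loop starts every exponent of [Gam f] has been a feasible target, so the
  whole polytope is the convex hull of [Lam f].

- The support of a vertex of the linear program is affinely independent
  ([lp_vertex_aff_indep]), so it has [m <= n.+1] points and [medset] consists
  of [m - 1 <= n] sets.  The common denominator [p] of the barycentric
  coordinates of [b] is at most [d ^ n.+1].  To see this, homogenize the
  exponents [a] to [(d - |a|, a)], vectors of naturals with sum [d]; some
  maximal minor [D] of the resulting matrix is nonzero, Cramer's rule gives
  [p %| D], and Leibniz' formula bounds [|D|] by the product [d ^ m] of the row
  sums.  The fractions subdivided later on have denominators at most [p]
  ([lmedset_denominator_le]).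

- [medseq p q] has fewer than [(log2 p + 3/2)^2 / 2] elements ([card_medseq]):
  a round costs at most [log2 p + 1] triples and halves [p], and these costs
  add up to a quadratic polynomial in [log2 p].

Since [2 * log2 d < log2 (1 + n d^2)], taking [p <= d ^ n.+1] yields the strict
inequality.  For the soft bound, [f] has at most ['C(d + n, d) <= 2 * d ^ n]
terms, which makes the estimate at most [81/4 * h * log2 h ^ 2] with
[h = d ^ n * n ^ 3]. *)

(** * The number of triples of a mediated sequence *)

Section Log2.

Variable R : realType.
Implicit Types x y : R.

Let ln2_gt0 : 0 < ln 2 :> R.
Proof. by apply: ln_gt0; lra. Qed.

Lemma log2_le x y : 0 < x -> x <= y -> log2 x <= log2 y.
Proof.
move=> x0 xy; rewrite /log2 ler_pM2r ?invr_gt0 // ler_ln // ?posrE //.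
exact: lt_le_trans xy.
Qed.

Lemma log2_lt x y : 0 < x -> x < y -> log2 x < log2 y.
Proof.
move=> x0 xy; rewrite /log2 ltr_pM2r ?invr_gt0 // ltr_ln // ?posrE //.
exact: lt_trans xy.
Qed.

Lemma log2_ge0 x : 1 <= x -> 0 <= log2 x.
Proof. by move=> x1; apply: divr_ge0; [apply: ln_ge0|apply: ltW]. Qed.

Lemma log2M x y : 0 < x -> 0 < y -> log2 (x * y) = log2 x + log2 y.
Proof. by move=> x0 y0; rewrite /log2 lnM ?posrE // mulrDl. Qed.

Lemma log2X x k : 0 < x -> log2 (x ^+ k) = k%:R * log2 x.
Proof. by move=> x0; rewrite /log2 lnXn // -(mulr_natl (ln x)) mulrA. Qed.

Lemma log2_2 : log2 2 = 1 :> R.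
Proof. by rewrite /log2 divff // gt_eqF. Qed.

Lemma log2_ge_nat (j a : nat) : (2 ^ j <= a)%N -> j%:R <= log2 a%:R :> R.
Proof.
move=> ja; have -> : j%:R = log2 (2 ^+ j) :> R by rewrite log2X // log2_2 mulr1.
by apply: log2_le; rewrite ?exprn_gt0 // -natrX ler_nat.
Qed.

End Log2.

(** The solution [G] of the recurrence [G (2 a) = G a + log2 (2 a) + 1]: this is
the cost of a round with [log2] of its argument plus one triples. *)
Definition medseq_bound (R : realType) (a : nat) : R :=
  (log2 a%:R + 3 / 2) ^+ 2 / 2.

Section MedSeqBound.

Variable R : realType.
Local Notation G := (@medseq_bound R).

Lemma medseq_bound_le (a b : nat) : (0 < a <= b)%N -> G a <= G b.
Proof.
move=> /andP[a0 ab]; rewrite /medseq_bound.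
have L0 : 0 <= log2 a%:R :> R by apply: log2_ge0; rewrite ler1n.
have L1 : log2 a%:R <= log2 b%:R :> R by apply: log2_le; rewrite ?ltr0n ?ler_nat.
nra.
Qed.

Lemma medseq_bound_double (h : nat) : (0 < h)%N -> 1 + G h <= G (2 * h).
Proof.
move=> h0; rewrite /medseq_bound natrM log2M ?ltr0n // log2_2.
have L0 : 0 <= log2 h%:R :> R by apply: log2_ge0; rewrite ler1n.
nra.
Qed.

(** One round for an odd [a]: a chain of [j] triples and one further triple,
followed by a call on some [h <= a / 2].  The chain has length [j <= log2 a]
because [2 ^ j] divides the even numerator, which is smaller than [a]. *)
Lemma medseq_bound_chain (j a h : nat) : (0 < h)%N -> (2 * h <= a)%N ->
  (2 ^ j <= a)%N -> j.+1%:R + G h <= G a.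
Proof.
move=> h0 ha /(log2_ge_nat R) La; rewrite /medseq_bound.
have L0 : 0 <= log2 h%:R :> R by apply: log2_ge0; rewrite ler1n.
have L1 : 1 + log2 h%:R <= log2 a%:R :> R.
  have -> : 1 + log2 h%:R = log2 (2 * h)%:R :> R.
    by rewrite natrM log2M ?ltr0n // log2_2.
  by apply: log2_le; rewrite ?ltr0n ?muln_gt0 // ler_nat.
rewrite -natr1; nra.
Qed.

Lemma medseq_bound_base (j a : nat) : (2 ^ j <= a)%N -> j.+1%:R < G a.
Proof.
move=> /(log2_ge_nat R) La; rewrite /medseq_bound -natr1.
have : 0 <= j%:R :> R by [].
nra.
Qed.

End MedSeqBound.

Lemma card_map_triples (X Y : choiceType) (h : X -> Y)
    (S : {fset X * X * X}) : (#|` map_triples h S| <= #|` S|)%N.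
Proof. by rewrite /map_triples (leq_trans (leq_imfset_card _ _ _)). Qed.

(** Dividing by the gcd only decreases the first argument, on which the bound is
monotone.  The odd/odd case costs nothing: it reflects the problem to an even
numerator with the same first argument, whence the induction measure, which
ranks odd/odd pairs above the others. *)
Lemma card_medseq (R : realType) (p q : nat) : (0 < q < p)%N ->
  #|` medseq p q|%:R < medseq_bound R p.
Proof.
have [k] := ubnP (2 * p - ~~ (odd p && odd q)).
elim: k p q => // k IH p q; rewrite ltnS => kp pq.
rewrite medseqE // /medseq_body.
set g := gcdn p q; set a := (p %/ g)%N; set b := (q %/ g)%N.
have g0 : (0 < g)%N by rewrite gcdn_gt0; lia.
have pE : p = (a * g)%N by rewrite divnK // dvdn_gcdl.
have qE : q = (b * g)%N by rewrite divnK // dvdn_gcdr.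
have [b0 ab] : (0 < b)%N /\ (b < a)%N by nia.
have ap : (a <= p)%N by nia.
have gp : (a < p)%N \/ (a = p /\ b = q) by nia.
have hb (x y : nat) := leq_b1 (~~ (odd x && odd y)).
have rec (p' q' : nat) : (0 < q' < p')%N ->
     (p' < p)%N \/ [/\ odd p, odd q, p' = p & ~~ odd q'] ->
     #|` medseq p' q'|%:R < medseq_bound R p'.
  move=> pq' H; apply: IH => //; have := hb p' q'; have := hb p q.
  case: H => [|[op oq pE' oq']]; first lia.
  by rewrite pE' op oq (negbTE oq') in kp *; lia.
have step (S : {fset int * int * int}) (N : nat) :
    (#|` S| <= N)%N -> N%:R < medseq_bound R a ->
    #|` map_triples (fun s : int => g%:Z * s) S|%:R < medseq_bound R p.
  move=> SN Na; apply: le_lt_trans (lt_le_trans Na _).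
    by rewrite ler_nat; apply: leq_trans SN; exact: card_map_triples.
  by apply: medseq_bound_le; lia.
case: ifPn => [ea|/negPn oa].
  have aE : a = (2 * (a %/ 2))%N by lia.
  have h0 : (0 < a %/ 2)%N by lia.
  have Ga : 1 + medseq_bound R (a %/ 2) <= medseq_bound R a.
    by rewrite [X in _ <= medseq_bound R X]aE; exact: medseq_bound_double.
  case: ifPn => bh.
    apply: (@step _ 1%N); first by rewrite cardfs1.
    by apply: (@medseq_bound_base _ 0); lia.
  case: ifPn => bh'.
    apply: (step _ (#|` medseq (a %/ 2) b| + 1)%N).
      by rewrite (leq_trans (leq_card_fsetU _ _)) // cardfs1.
    rewrite natrD addrC; apply: lt_le_trans Ga.
    by rewrite ltrD2l; apply: rec; lia.
  apply: (step _ (1 + #|` medseq (a %/ 2) (b - a %/ 2)|)%N).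
    by rewrite (leq_trans (leq_card_fsetU _ _)) // cardfs1 leq_add2l
       card_map_triples.
  rewrite natrD; apply: lt_le_trans Ga.
  by rewrite ltrD2l; apply: rec; lia.
case: ifPn => [eb|/negPn ob]; last first.
  apply: (step _ #|` medseq a (a - b)|); first exact: card_map_triples.
  apply: rec; first lia.
  case: gp => [ap'|[aE bE]]; [left; lia | right; split; lia].
set j := logn 2 b; set r := (b %/ 2 ^ j)%N.
have bE : b = (r * 2 ^ j)%N by rewrite divnK // pfactor_dvdnn.
have j0 : (0 < j)%N by rewrite logn_gt0 mem_primes /= b0 dvdn2.
have r0 : (0 < r)%N by move: b0; rewrite {1}bE muln_gt0 => /andP[].
have ja : (2 ^ j <= a)%N.
  by apply: leq_trans (ltnW ab); rewrite [leqRHS]bE leq_pmull.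
have rb : (2 * r <= b)%N.
  have j2 : (2 <= 2 ^ j)%N by rewrite -[leqLHS](expn1 2) leq_exp2l.
  by rewrite [leqRHS]bE mulnC leq_mul2l j2 orbT.
have or : odd r.
  have := @pfactor_coprime 2 b isT b0 => -[r' cr' br'].
  suff -> : r = r' by rewrite coprime2n in cr'.
  by rewrite /r {1}br' mulnK // expn_gt0.
set E := imfset _ _ _.
have cE : (#|` E| <= j)%N.
  apply: leq_trans (leq_imfset_card _ _ _) _.
  by apply: leq_trans (size_undup _) _; rewrite size_iota.
have cE1 (e : int * int * int) : (#|` (E `|` [fset e])%fset| <= j.+1)%N.
  by rewrite (leq_trans (leq_card_fsetU _ _)) // cardfs1 addn1.
case: ifPn => bar.
  apply: (step _ j.+1); first exact: cE1.
  exact: medseq_bound_base.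
have tail (e : int * int * int) (c : int) (q' : nat) :
    (0 < q' < (a + r - b) %/ 2)%N ->
    #|` map_triples (fun s : int => g%:Z * s)
        (E `|` [fset e] `|` map_triples (fun s : int => (s + c)%R)
           (medseq ((a + r - b) %/ 2) q'))%fset|%:R < medseq_bound R p.
  move=> q'P; have [h0 ha] : (0 < (a + r - b) %/ 2)%N /\
      (2 * ((a + r - b) %/ 2) <= a)%N by clear -q'P r0 rb; lia.
  apply: (step _ (j.+1 + #|` medseq ((a + r - b) %/ 2) q'|)%N).
    by rewrite (leq_trans (leq_card_fsetU _ _)) // leq_add // card_map_triples.
  rewrite natrD; apply: lt_le_trans (medseq_bound_chain R h0 ha ja).
  by rewrite ltrD2l; apply: rec => //; left; clear -h0 ha ap; lia.
case: ifPn => bar'; apply: tail; clear -bar r0 rb ab or oa eb bar'; lia.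
Qed.

(** * Denominators of barycentric coordinates *)

(** Expanding the product of the row sums gives one term for each function
[i |-> j], and the permutations are among these functions. *)
Lemma det_le_row_sums (F : numDomainType) (m : nat) (A : 'M[F]_m) :
  `|\det A| <= \prod_i \sum_j `|A i j|.
Proof.
rewrite bigA_distr_bigA /=.
have pval_inj : {in predT &, injective (@pval 'I_m)}.
  by move=> s t _ _; exact: val_inj.
apply: le_trans (_ : \sum_(s : 'S_m) \prod_i `|A i (s i)| <= _).
  apply: le_trans (ler_norm_sum _ _ _) _; apply: ler_sum => s _.
  by rewrite normrM normrX normrN1 expr1n mul1r normr_prod.
rewrite (bigID (mem (@pval 'I_m @: predT))) /= big_imset //=.
have -> : \sum_(s : 'S_m) \prod_i `|A i (s i)| =
    \sum_(s : 'S_m) \prod_i `|A i (pval s i)|.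
  by apply: eq_bigr => s _; apply: eq_bigr => i _; rewrite pvalE.
rewrite lerDl; apply: sumr_ge0 => f _; exact: prodr_ge0.
Qed.

Lemma dvdn_foldr_gcd (p D : nat) (s : seq nat) :
  (forall x, x \in s -> p %| D * x)%N -> (p %| D * foldr gcdn p s)%N.
Proof.
elim: s => [|x s IH] /= H; first by rewrite dvdn_mull.
rewrite muln_gcdr dvdn_gcd H ?mem_head // IH // => y ys.
by apply: H; rewrite inE ys orbT.
Qed.

(** Cramer's rule: on a nonzero maximal minor [D] of [M], the solution [q / p] has
[D * q_i] divisible by [p] for all [i], and hence [D] divisible by [p] when the
fractions have no smaller common denominator. *)
Lemma common_denominator_le (m N p : nat) (M : 'M[int]_(m, N)) (v : 'rV[int]_N)
    (q : seq nat) :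
  row_free (map_mx (intr : int -> rat) M) -> size q = m ->
  foldr gcdn p q = 1%N ->
  (\row_(i < m) (nth 0%N q i)%:Z) *m M = p%:Z *: v ->
  p%:Z <= \prod_i \sum_j `|M i j|.
Proof.
move=> freeM sq gq qM.
have full : row_full (map_mx (intr : int -> rat) M)^T.
  by rewrite /row_full mxrank_tr.
(* [f] selects [m] columns on which [M] is invertible. *)
pose f := fullrankfun full; pose B : 'M[int]_m := \matrix_(i, j) M i (f j).
have B0 : \det B != 0.
  have : (map_mx (intr : int -> rat) B)^T \in unitmx.
    rewrite (_ : _^T = rowsub f (map_mx intr M)^T) ?fullrowsub_unit //.
    by apply/matrixP => i j; rewrite !mxE.
  rewrite unitmx_tr unitmxE unitfE det_map_mx; apply: contraNneq => ->.
  by rewrite rmorph0.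
have qB : (\row_(i < m) (nth 0%N q i)%:Z) *m B = p%:Z *: (\row_j v 0 (f j)).
  apply/rowP => j; move/rowP/(_ (f j)): qM; rewrite !mxE => <-.
  by apply: eq_bigr => i _; rewrite !mxE.
have dvd x : x \in q -> (p %| `|\det B|%N * x)%N.
  move=> xq; have ix : (index x q < m)%N by rewrite -sq index_mem.
  have := congr1 (fun u : 'rV_m => (u *m \adj B) 0 (Ordinal ix)) qB.
  rewrite -mulmxA mul_mx_adj -scalemxAl mul_mx_scalar !mxE /= nth_index // => E.
  have : (p%:Z %| \det B * x%:Z)%Z by rewrite E dvdz_mulr.
  by rewrite dvdzE abszM.
have {}dvd : (p <= `|\det B|)%N.
  by apply: dvdn_leq; [rewrite absz_gt0 | rewrite -[X in (_ %| X)%N]muln1 -gq dvdn_foldr_gcd].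
have pD : p%:Z <= `|\det B| by rewrite -abszE lez_nat.
apply: le_trans pD _; apply: le_trans (det_le_row_sums _) _.
apply: ler_prod => i _; rewrite sumr_ge0 //=.
have finj : {in predT &, injective f} by move=> ? ? _ _; exact: fullrankfun_inj.
rewrite [leRHS](bigID (mem (f @: predT))) /=.
rewrite big_imset //=.
under eq_bigr do rewrite mxE.
by rewrite lerDl sumr_ge0.
Qed.

(** Affine independence of the points of a list, over the rationals and with the
coefficients indexed by position, as [medset] uses them. *)
Definition aff_free (n : nat) (ts : seq 'X_{1..n}) : Prop :=
  forall c : nat -> rat,
    \sum_(0 <= i < size ts) c i = 0 ->
    \sum_(0 <= i < size ts) c i *: evec rat (nth 0%MM ts i) = 0 ->
    forall i, (i < size ts)%N -> c i = 0.

Lemma aff_indep_free (R : realType) (n : nat) (T : {fset 'X_{1..n}})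
    (ts : seq 'X_{1..n}) :
  uniq ts -> ts =i T -> aff_indep R T -> aff_free ts.
Proof.
move=> uts tsT indT c c0 c1 i im.
pose mu a : R := ratr (c (index a ts)).
have pT : perm_eq T ts by apply: uniq_perm => // x; rewrite tsT.
have cE j : (j < size ts)%N -> mu (nth 0%MM ts j) = ratr (c j).
  by move=> jm; rewrite /mu index_uniq.
have : mu (nth 0%MM ts i) = 0.
  apply: indT.
  - rewrite (perm_big _ pT) (big_nth 0%MM) /=.
    rewrite (eq_big_nat _ _ (F2 := fun j => ratr (c j))) => [|j /andP[_ /cE]] //.
    by rewrite -rmorph_sum c0 rmorph0.
  - rewrite (perm_big _ pT) (big_nth 0%MM) /=.
    apply/rowP => k; rewrite summxE mxE.
    rewrite (eq_big_nat _ _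
      (F2 := fun j => ratr (c j * (nth 0%MM ts j k)%:R))); last first.
      by move=> j /andP[_ jm]; rewrite !mxE cE // rmorphM /= ratr_nat.
    rewrite -rmorph_sum -[RHS](rmorph0 (@ratr R)); congr ratr.
    move/rowP/(_ k): c1; rewrite summxE mxE => c1; rewrite -[RHS]c1.
    by apply: eq_bigr => j _; rewrite !mxE.
  - by rewrite -tsT mem_nth.
by rewrite cE // => /eqP; rewrite fmorph_eq0 => /eqP.
Qed.

(** Homogenizing in degree [d] turns affine into linear independence and gives
rows of naturals with sum [d].  Putting [1] as the extra coordinate would also
linearize, but with row sums up to [d + 1], too large when [n = 1]. *)
Definition homogenized (n d : nat) (a : 'X_{1..n}) (k : 'I_(1 + n)) : int :=
  match split k with inl _ => d%:Z - (mdeg a)%:Z | inr i => (a i)%:Z end.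

Lemma homogenized_l (n d : nat) (a : 'X_{1..n}) (i : 'I_1) :
  homogenized d a (lshift n i) = d%:Z - (mdeg a)%:Z.
Proof. by rewrite /homogenized (unsplitK (inl i)). Qed.

Lemma homogenized_r (n d : nat) (a : 'X_{1..n}) (i : 'I_n) :
  homogenized d a (rshift 1 i) = (a i)%:Z.
Proof. by rewrite /homogenized (unsplitK (inr i)). Qed.

Lemma homogenized_free (n d : nat) (ts : seq 'X_{1..n}) : (0 < d)%N ->
  aff_free ts ->
  row_free (map_mx (intr : int -> rat)
    (\matrix_(i < size ts, k < 1 + n) homogenized d (nth 0%MM ts i) k)).
Proof.
move=> d0 fts; apply: inj_row_free => c cM.
pose c' i : rat := if insub i is Some j then c 0 j else 0.
have c'E (j : 'I_(size ts)) : c' j = c 0 j by rewrite /c' valK.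
have ck k : \sum_(j < size ts) c 0 j * (nth 0%MM ts j k)%:R = 0.
  move/rowP/(_ (rshift 1 k)): cM; rewrite !mxE => cM; rewrite -[RHS]cM.
  by apply: eq_bigr => j _; rewrite !mxE homogenized_r.
have cs : \sum_(j < size ts) c 0 j = 0.
  move/rowP/(_ (lshift n 0)): cM; rewrite !mxE.
  under eq_bigr do rewrite !mxE homogenized_l rmorphB /= mulrBr.
  rewrite sumrB -mulr_suml [X in _ - X](_ : _ = 0) ?subr0; last first.
    under eq_bigr do rewrite mdegE -pmulrn natr_sum mulr_sumr.
    by rewrite exchange_big big1.
  by move/eqP; rewrite mulf_eq0 -pmulrn pnatr_eq0 eqn0Ngt d0 orbF => /eqP.
apply/rowP => j; rewrite mxE -c'E; apply: fts => //.
- by rewrite big_mkord; under eq_bigr do rewrite c'E.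
- apply/rowP => k; rewrite big_mkord summxE mxE -[RHS](ck k).
  by apply: eq_bigr => i _; rewrite !mxE c'E.
Qed.

(** The rows of the homogenized matrix sum to [d], so the product of the row sums
is [d ^ size ts]. *)
Lemma barycentric_denominator_le (n d : nat) (ts : seq 'X_{1..n})
    (b : 'X_{1..n}) (q : seq nat) :
  (0 < d)%N -> (forall a, a \in ts -> (mdeg a <= d)%N) -> aff_free ts ->
  size q = size ts -> (0 < sumn q)%N -> foldr gcdn (sumn q) q = 1%N ->
  evec rat b = \sum_(0 <= i < size ts)
    ((nth 0%N q i)%:R / (sumn q)%:R) *: evec rat (nth 0%MM ts i) ->
  (size ts <= n.+1)%N /\ (sumn q <= d ^ size ts)%N.
Proof.
move=> d0 dts fts sq p0 gq bE; set p := sumn q in p0 gq bE *.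
have free := homogenized_free d0 fts.
split; first by have /eqP <- := free; exact: rank_leq_col.
have pE : p = (\sum_(j < size ts) nth 0%N q j)%N.
  by rewrite /p sumnE (big_nth 0%N) sq big_mkord.
have bk k : (p * b k = \sum_(j < size ts) nth 0%N q j * nth 0%MM ts j k)%N.
  apply/eqP; rewrite -(eqr_nat rat) natrM natr_sum.
  move/rowP/(_ k): bE; rewrite big_mkord summxE mxE => ->; apply/eqP.
  rewrite mulr_sumr; apply: eq_bigr => j _; rewrite !mxE natrM mulrA mulrCA.
  by rewrite divff ?mulr1 // pnatr_eq0 -lt0n.
have := common_denominator_le (v := \row_k homogenized d b k) free sq gq.
have -> : \prod_(i < size ts) \sum_k
    `|(\matrix_(i < size ts, k < 1 + n) homogenized d (nth 0%MM ts i) k) i k|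
    = (d ^ size ts)%N%:Z.
  rewrite (eq_bigr (fun=> d%:Z)) => [|i _]; last first.
    rewrite big_split_ord /= big_ord1.
    under [X in _ + X]eq_bigr do rewrite mxE homogenized_r.
    rewrite mxE homogenized_l ger0_norm; last first.
      by rewrite subr_ge0 lez_nat dts // mem_nth.
    by rewrite -(big_morph Posz PoszD (erefl _)) -mdegE subrK.
  by rewrite prodr_const card_ord -[RHS]natz natrX natz.
rewrite lez_nat; apply; apply/rowP => k; rewrite !mxE -(splitK k).
case: (split k) => {}k /=.
  under eq_bigr do rewrite !mxE homogenized_l mulrBr.
  rewrite homogenized_l sumrB -mulr_suml mulrBr; congr (_ * _ - _).
    by rewrite pE (big_morph Posz PoszD (erefl _)).
  have -> : p%:Z * (mdeg b)%:Z =
      (\sum_(j < size ts) nth 0%N q j * mdeg (nth 0%MM ts j))%N%:Z.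
    rewrite -PoszM mdegE big_distrr /=; under eq_bigr do rewrite bk.
    rewrite exchange_big /=; congr Posz.
    by apply: eq_bigr => j _; rewrite mdegE big_distrr.
  by rewrite (big_morph Posz PoszD (erefl _)).
rewrite homogenized_r -PoszM bk (big_morph Posz PoszD (erefl _)).
by apply: eq_bigr => j _; rewrite !mxE homogenized_r -PoszM.
Qed.

(** * The triples of one circuit *)

(** The barycentric coordinates of the partial barycenter [beta_j], extended by
[0] to all points: for [j] the last index they describe [alpha_m] itself, so
that the last segment of [medset] has the same form as the others. *)
Definition tail_weight (q : seq nat) (j i : nat) : rat :=
  if (j <= i)%N then
    (nth 0%N q i)%:R / (sumn q - \sum_(0 <= l < j) nth 0%N q l)%N%:R
  else 0.

Lemma tail_sumE (q : seq nat) (j : nat) : (j <= size q)%N ->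
  (sumn q - \sum_(0 <= l < j) nth 0%N q l
    = \sum_(j <= l < size q) nth 0%N q l)%N.
Proof.
by move=> jm; rewrite sumnE (big_nth 0%N) (big_cat_nat (leq0n j) jm) addKn.
Qed.

Lemma tail_sum_gt0 (q : seq nat) (j : nat) : all (fun x => 0 < x)%N q ->
  (j < size q)%N -> (0 < sumn q - \sum_(0 <= l < j) nth 0%N q l)%N.
Proof.
move=> q0 jm; rewrite (tail_sumE (ltnW jm)) big_ltn //=.
by rewrite addn_gt0 (allP q0) // mem_nth.
Qed.

Lemma sum_tail_weight (V : lmodType rat) (q : seq nat) (v : nat -> V) (j : nat) :
  (j <= size q)%N ->
  \sum_(0 <= i < size q) tail_weight q j i *: v i =
  \sum_(j <= i < size q)
    ((nth 0%N q i)%:R / (sumn q - \sum_(0 <= l < j) nth 0%N q l)%N%:R) *: v i.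
Proof.
move=> jm; rewrite (big_cat_nat (leq0n j) jm) /= big_nat big1 ?add0r => [|i].
  by apply: eq_big_nat => i /andP[ji _]; rewrite /tail_weight ji.
by move=> /andP[_ ij]; rewrite /tail_weight leqNgt ij scale0r.
Qed.

Lemma tail_weight_sum1 (q : seq nat) (j : nat) :
  all (fun x => 0 < x)%N q -> (j < size q)%N ->
  \sum_(0 <= i < size q) tail_weight q j i = 1.
Proof.
move=> q0 jm; rewrite (big_cat_nat (leq0n j) (ltnW jm)) /= big_nat big1 ?add0r.
  rewrite (eq_big_nat _ _ (F2 := fun i => (nth 0%N q i)%:R /
    (sumn q - \sum_(0 <= l < j) nth 0%N q l)%N%:R)) => [|i /andP[ji _]].
    rewrite -mulr_suml -natr_sum (tail_sumE (ltnW jm)) divff //.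
    by rewrite pnatr_eq0 -lt0n -(tail_sumE (ltnW jm)) tail_sum_gt0.
  by rewrite /tail_weight ji.
by move=> i /andP[_ ij]; rewrite /tail_weight leqNgt ij.
Qed.

(** By affine independence the coefficient of [alpha_j] in [beta_j] is determined,
so [q' / p'] is the quotient of two consecutive tail sums of [q]; being in
lowest terms, it has a denominator dividing the larger one.  Independence is
essential: if [alpha_j] and [beta_(j+1)] coincided, [p'] would be arbitrary. *)
Lemma lmedset_denominator_le (n : nat) (ts : seq 'X_{1..n}) (q : seq nat)
    (j p' q' : nat) :
  aff_free ts -> size q = size ts -> all (fun x => 0 < x)%N q ->
  (j.+1 < size ts)%N -> (0 < p')%N -> coprime p' q' ->
  \sum_(0 <= i < size ts) tail_weight q j i *: evec rat (nth 0%MM ts i) =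
    (1 - q'%:R / p'%:R) *: evec rat (nth 0%MM ts j) +
    (q'%:R / p'%:R) *:
      \sum_(0 <= i < size ts) tail_weight q j.+1 i *: evec rat (nth 0%MM ts i) ->
  (p' <= sumn q)%N.
Proof.
move=> fts sq q0 jm p0 cpq E; have jm' : (j < size ts)%N by exact: ltnW.
set x := q'%:R / p'%:R in E.
pose P k := (sumn q - \sum_(0 <= l < k) nth 0%N q l)%N.
have P0 k : (k < size ts)%N -> (0 < P k)%N.
  by move=> km; apply: tail_sum_gt0; rewrite ?sq.
have PS : P j = (nth 0%N q j + P j.+1)%N.
  by rewrite /P !tail_sumE ?sq // 1?ltnW // big_ltn.
(* The affine relation between [beta_j], [alpha_j] and [beta_(j+1)]. *)
pose c i := tail_weight q j i - (1 - x) * (i == j)%:R - x * tail_weight q j.+1 i.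
have delta1 : \sum_(0 <= i < size ts) (1 - x) * (i == j)%:R = 1 - x.
  rewrite big_mkord (bigD1 (Ordinal jm')) //= eqxx mulr1 big1 ?addr0 // => i.
  by rewrite -val_eqE /= => /negbTE->; rewrite mulr0.
have delta (V : lmodType rat) (v : nat -> V) :
    \sum_(0 <= i < size ts) ((1 - x) * (i == j)%:R) *: v i = (1 - x) *: v j.
  rewrite big_mkord (bigD1 (Ordinal jm')) //= eqxx mulr1 big1 ?addr0 // => i.
  by rewrite -val_eqE /= => /negbTE->; rewrite mulr0 scale0r.
have /eqP : c j = 0.
  apply: fts => //.
  - by rewrite /c !sumrB delta1 -mulr_sumr -sq !tail_weight_sum1 ?sq //
      mulr1 opprB addrCA subrr addr0 subrr.
  - under eq_bigr do rewrite /c !scalerBl.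
    rewrite !sumrB delta E; under [X in _ - X]eq_bigr do rewrite -scalerA.
    by rewrite -scaler_sumr addrAC addrK subrr.
rewrite /c eqxx mulr1 /tail_weight leqnn ltnn mulr0 subr0 -/(P j).
rewrite subr_eq0 => /eqP xE.
suff : (p' %| P j)%N by move/dvdn_leq => /(_ (P0 _ jm')) /leq_trans-> //; exact: leq_subr.
rewrite -(Gauss_dvdr _ cpq); apply/dvdnP; exists (P j.+1).
have Pj0 : (P j)%:R != 0 :> rat by rewrite pnatr_eq0 -lt0n P0.
have p'0 : p'%:R != 0 :> rat by rewrite pnatr_eq0 -lt0n.
apply/eqP; rewrite -(eqr_nat rat) !natrM.
have -> : (P j.+1)%:R = x * (P j)%:R :> rat.
  have -> : x = 1 - (nth 0%N q j)%:R / (P j)%:R by rewrite xE; lra.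
  by rewrite mulrBl mul1r divfK // PS natrD addrC addKr.
by rewrite mulrAC divfK.
Qed.

Lemma card_medset (R : realType) (n d : nat) (T : {fset 'X_{1..n}})
    (b : 'X_{1..n}) (S : {fset 'rV[rat]_n * 'rV[rat]_n * 'rV[rat]_n}) :
  (0 < d)%N -> (forall a, a \in T -> (mdeg a <= d)%N) -> aff_indep R T ->
  medset T b S -> #|` S|%:R <= n%:R * medseq_bound R (d ^ n.+1).
Proof.
move=> d0 dT indT [ts [q [Ss]]] /= [[uts tsT m1] [sq q0 gq bE] HS HL ->].
have fts := aff_indep_free uts tsT indT.
have p0 : (0 < sumn q)%N.
  by have := tail_sum_gt0 (j := 0) q0; rewrite big_geq // subn0 sq; apply; lia.
have [mn pd] : (size ts <= n.+1)%N /\ (sumn q <= d ^ n.+1)%N.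
  have dts a : a \in ts -> (mdeg a <= d)%N by rewrite tsT => /dT.
  have [|mn pd] := @barycentric_denominator_le _ _ ts b q d0 dts fts sq p0 gq.
    by rewrite bE; apply: eq_bigr => i _; rewrite big_geq // subn0.
  by split=> //; apply: leq_trans pd _; rewrite leq_pexp2l.
pose be j := \sum_(0 <= i < size ts) tail_weight q j i *: evec rat (nth 0%MM ts i).
have beE j : (j <= size ts)%N -> \sum_(j <= i < size ts)
    ((nth 0%N q i)%:R / (sumn q - \sum_(0 <= l < j) nth 0%N q l)%N%:R) *:
      evec rat (nth 0%MM ts i) = be j.
  by rewrite /be -sq => /sum_tail_weight ->.
have lmed j : (j < (size ts).-1)%N ->
    lmedset (evec rat (nth 0%MM ts j)) (be j.+1) (be j) (Ss j).
  move=> jm; case: (ltnP j (size ts - 2)) => jm2.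
    by have := HS j jm2; rewrite !beE //; lia.
  have jE : j = (size ts - 2)%N by lia.
  move: HL; rewrite -jE beE; last by lia.
  suff -> : evec rat (nth 0%MM ts (size ts - 1)) = be j.+1 by [].
  have jS : j.+1 = (size ts).-1 by lia.
  rewrite -beE; last by lia.
  have sE : size ts = j.+2 by lia.
  have := tail_sum_gt0 (j := j.+1) q0.
  rewrite tail_sumE sq sE // !big_nat1 => /(_ (ltnSn _)) q1.
  by rewrite divff ?scale1r ?subn1 // pnatr_eq0 -lt0n.
have card1 j : (j < (size ts).-1)%N ->
    #|` Ss j|%:R <= medseq_bound R (d ^ n.+1).
  move=> jm; have [p' [q' [pq' cpq bj ->]]] := lmed j jm.
  have p'p : (p' <= sumn q)%N.
    by apply: (lmedset_denominator_le fts sq q0 _ _ cpq bj); lia.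
  apply: (@le_trans _ _ (#|` medseq p' q'|%:R)).
    by rewrite ler_nat card_map_triples.
  apply: le_trans (ltW (card_medseq R pq')) _.
  by apply: medseq_bound_le; rewrite (leq_trans p'p pd) andbT; lia.
apply: (@le_trans _ _ (\sum_(j < (size ts).-1) #|` Ss j|%:R)).
  rewrite -natr_sum ler_nat.
  elim/big_ind2 : _ => [|A x B y Ax By|//]; first by rewrite cardfs0.
  by apply: leq_trans (leq_card_fsetU _ _) _; exact: leq_add.
apply: (@le_trans _ _ (\sum_(j < (size ts).-1) medseq_bound R (d ^ n.+1))).
  by apply: ler_sum => j _; exact: card1.
rewrite sumr_const card_ord -[leLHS]mulr_natl; apply: ler_wpM2r.
  by rewrite /medseq_bound divr_ge0 ?sqr_ge0.
by rewrite ler_nat; lia.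
Qed.

(** * Minimal faces and the linear program *)

Lemma conv_hull_convex (R : realType) (n : nat) (A : set 'rV[R]_n)
    (x y : 'rV[R]_n) (t : R) :
  conv_hull A x -> conv_hull A y -> 0 <= t <= 1 ->
  conv_hull A ((1 - t) *: x + t *: y).
Proof.
move=> [s1 [s1A s11 ->]] [s2 [s2A s21 ->]] /andP[t0 t1].
exists ([seq ((1 - t) * e.1, e.2) | e <- s1] ++ [seq (t * e.1, e.2) | e <- s2]).
split.
- move=> e; rewrite mem_cat => /orP[] /mapP[e' /= + ->] /=.
    by move/s1A => [e0 eA]; split=> //; rewrite mulr_ge0 // subr_ge0.
  by move/s2A => [e0 eA]; split=> //; rewrite mulr_ge0.
- by rewrite big_cat !big_map /= -!mulr_sumr s11 s21 !mulr1 subrK.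
- rewrite big_cat !big_map /= !scaler_sumr.
  by congr (_ + _); apply: eq_bigr => e _; rewrite scalerA.
Qed.

Lemma conv_hull_mem (R : realType) (n : nat) (A : set 'rV[R]_n) (x : 'rV[R]_n) :
  A x -> conv_hull A x.
Proof.
move=> Ax; exists [:: (1, x)]; split.
- by move=> e; rewrite inE => /eqP ->; split.
- by rewrite big_seq1.
- by rewrite big_seq1 scale1r.
Qed.

(** The points [x] of [P] from which the segment through [b] can be prolonged
beyond [b] inside [P]; for a polytope, the smallest face containing [b]. *)
Definition min_face (R : realType) (n : nat) (P : set 'rV[R]_n) (b : 'rV[R]_n) :
    set 'rV[R]_n :=
  [set x | P x /\ exists2 s : R, 0 < s & P ((1 + s) *: b - s *: x)]%classic.

(** Prolongations can be shortened, so two points of [min_face] have a common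
prolongation factor [s], for which convexity is immediate.  If a point strictly
between [x] and [y] has a prolongation [w], then the segment from [x] through
[b] meets the segment from [w] to [y], beyond [b]. *)
Lemma min_face_face (R : realType) (n : nat) (P : set 'rV[R]_n) (b : 'rV[R]_n) :
  P b ->
  (forall x y (t : R), P x -> P y -> 0 <= t <= 1 ->
     P ((1 - t) *: x + t *: y)) ->
  face P (min_face P b).
Proof.
move=> Pb convP; split=> [x []//|x y t|x y t Px Py].
  have shrink (z : 'rV[R]_n) (s r : R) : 0 <= r <= 1 ->
      P ((1 + s) *: b - s *: z) -> P ((1 + r * s) *: b - (r * s) *: z).
    move=> r01 Pz.
    have -> : (1 + r * s) *: b - (r * s) *: z =
        (1 - r) *: b + r *: ((1 + s) *: b - s *: z).
      by apply/rowP => i; rewrite !mxE; lra.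
    exact: convP.
  move=> [Px [s s0 Ps]] [Py [u u0 Pu]] t01; split; first exact: convP.
  pose m := Num.min s u; have m0 : 0 < m by rewrite lt_min s0.
  have to_m (z : 'rV[R]_n) (v : R) : 0 < v -> m <= v ->
      P ((1 + v) *: b - v *: z) -> P ((1 + m) *: b - m *: z).
    move=> v0 mv /(@shrink _ _ (m / v)); rewrite divfK ?gt_eqF //; apply.
    by rewrite ler_pdivrMr // mul1r mv andbT divr_ge0 // ltW.
  have [ms mu] : m <= s /\ m <= u by rewrite !ge_min !lexx orbT.
  exists m => //.
  have {}Ps := to_m _ _ s0 ms Ps.
  have {}Pu := to_m _ _ u0 mu Pu.
  have -> : (1 + m) *: b - m *: ((1 - t) *: x + t *: y) =
      (1 - t) *: ((1 + m) *: b - m *: x) + t *: ((1 + m) *: b - m *: y).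
    by apply/rowP => i; rewrite !mxE; lra.
  exact: convP.
have half (x' y' : 'rV[R]_n) (v : R) : P x' -> P y' -> 0 < v < 1 ->
    min_face P b ((1 - v) *: x' + v *: y') -> min_face P b x'.
  move=> Px' Py' /andP[v0 v1] [_ [s s0 Ps]]; split=> //.
  have sv : 0 < 1 + s * v by rewrite ltr_wpDl // mulr_gt0.
  pose k := (1 + s * v)^-1.
  have kE : k + s * v * k = 1.
    by rewrite -{1}[k]mul1r -mulrDl mulfV // gt_eqF.
  have k0 : 0 < k by rewrite invr_gt0.
  (* This factor is where the line from [x'] through [b] meets the segment from
     the prolonged point to [y']. *)
  exists (s * (1 - v) * k); first by rewrite !mulr_gt0 // subr_gt0.
  have -> : (1 + s * (1 - v) * k) *: b - (s * (1 - v) * k) *: x' =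
     (1 - (1 - k)) *: ((1 + s) *: b - s *: ((1 - v) *: x' + v *: y')) +
     (1 - k) *: y'.
    apply/rowP => i; rewrite !mxE.
    have hb : b 0 i = (k + s * v * k) * b 0 i by rewrite kE mul1r.
    have hy : y' 0 i = (k + s * v * k) * y' 0 i by rewrite kE mul1r.
    lra.
  apply: convP => //; apply/andP; split; last by lra.
  by rewrite subr_ge0 -kE lerDl !mulr_ge0 // ltW.
move=> /andP[t0 t1] Fz; split.
  by apply: half Fz => //; rewrite t0.
apply: (half _ x (1 - t)) => //; first by rewrite subr_gt0 t1 ltrBlDr ltrDl.
by rewrite subKr addrC.
Qed.

Section Cover.

Variables (R : realType) (n : nat) (f : {mpoly R[n]}).
Implicit Types (U V T : {fset 'X_{1..n}}) (a b : 'X_{1..n}) (la : 'X_{1..n} -> R).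

Lemma in_Gam b : (b \in Gam f) = (b \in msupp f) && (b \notin Lam f).
Proof. by rewrite !inE. Qed.

(** [lp_feasible] for an arbitrary target point, needed for the points of the
Newton polytope. *)
Definition lp_weights (x : 'rV[R]_n) la : Prop :=
  [/\ \sum_(a <- Lam f) la a *: evec R a = x,
      \sum_(a <- Lam f) la a = 1 &
      forall a, a \in Lam f -> 0 <= la a].

Lemma sum_delta (W : lmodType R) (v : 'X_{1..n} -> W) a0 : a0 \in Lam f ->
  \sum_(a <- Lam f) (a == a0)%:R *: v a = v a0.
Proof.
move=> a0L; rewrite (bigD1_seq a0 a0L (fset_uniq _)) /= eqxx scale1r big1 ?addr0 // => a.
by move=> /negbTE->; rewrite scale0r.
Qed.

Lemma sum_delta1 a0 : a0 \in Lam f -> \sum_(a <- Lam f) (a == a0)%:R = 1 :> R.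
Proof.
move=> a0L; rewrite (bigD1_seq a0 a0L (fset_uniq _)) /= eqxx big1 ?addr0 // => a.
by move=> /negbTE->.
Qed.

(** Stated for conic combinations, for which the induction on the list needs no
renormalization. *)
Lemma lp_weights_cone (s : seq (R * 'rV[R]_n)) :
  (forall e, e \in s -> 0 <= e.1 /\ exists la, lp_weights e.2 la) ->
  exists la, [/\ \sum_(a <- Lam f) la a *: evec R a = \sum_(e <- s) e.1 *: e.2,
      \sum_(a <- Lam f) la a = \sum_(e <- s) e.1 &
      forall a, a \in Lam f -> 0 <= la a].
Proof.
elim: s => [|e s IH] H.
  exists (fun=> 0); split=> //; first by rewrite !big_nil big1 // => a _; rewrite scale0r.
  by rewrite !big_nil big1.
have [|la [la1 la2 la3]] := IH; first by move=> x xs; apply: H; rewrite inE xs orbT.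
have [e0 [mu [mu1 mu2 mu3]]] := H _ (mem_head _ _).
exists (fun a => e.1 * mu a + la a); rewrite !big_cons; split.
- rewrite -la1 -mu1 scaler_sumr -big_split; apply: eq_bigr => a _ /=.
  by rewrite scalerDl scalerA.
- by rewrite big_split -mulr_sumr mu2 mulr1 la2.
- by move=> a aL; rewrite addr_ge0 ?la3 // mulr_ge0 ?mu3.
Qed.

(** The vertices of the Newton polytope outside [Lam f] are harmless once each of
them is known to be a convex combination of points of [Lam f]. *)
Lemma newton_weights (x : 'rV[R]_n) :
  (forall b, b \in Gam f -> exists la, lp_feasible f b la) ->
  newton f x -> exists la, lp_weights x la.
Proof.
move=> feas [s [sA s1 ->]].
have [|la [la1 la2 la3]] := @lp_weights_cone s; last first.
  by exists la; split; rewrite ?la1 ?la2 ?s1.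
move=> e /sA[e0 [a /= af <-]]; split=> //.
have [aL|aL] := boolP (a \in Lam f); last first.
  by apply: feas; rewrite in_Gam af aL.
exists (fun c => (c == a)%:R); split; [exact: sum_delta|exact: sum_delta1|].
by move=> c _; rewrite ler0n.
Qed.

(** Since [a0] is in the minimal face of [b], the point [(1 + s) b - s a0] is in
the Newton polytope for some [s > 0].  Its weights, averaged with those of [a0],
are feasible weights of [b] that are positive at [a0]. *)
Lemma optimal_weight_gt0 b a0 la :
  (forall b, b \in Gam f -> exists la, lp_feasible f b la) ->
  b \in Gam f -> a0 \in Lam f ->
  (forall F, face (newton f) F -> F (evec R b) -> F (evec R a0)) ->
  (forall mu, lp_feasible f b mu -> mu a0 <= la a0) ->
  0 < la a0.
Proof.
move=> feas bG a0L onface opt.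
have Pb : newton f (evec R b).
  by apply: conv_hull_mem; exists b => //=; move: bG; rewrite in_Gam => /andP[].
have [] : min_face (newton f) (evec R b) (evec R a0).
  apply: onface.
    by apply: min_face_face => // x y t; exact: conv_hull_convex.
  split=> //; exists 1 => //.
  by rewrite (_ : _ - _ = evec R b) // scalerDl scale1r addrK.
move=> _ [s s0 /(newton_weights feas)[nu [nu1 nu2 nu3]]].
have s1 : 0 < 1 + s by rewrite ltr_wpDl.
pose mu a := (1 + s)^-1 * (s * (a == a0)%:R + nu a).
have mu_feas : lp_feasible f b mu.
  split.
  - under eq_bigr do rewrite /mu -scalerA scalerDl -scalerA.
    rewrite -scaler_sumr big_split /= -scaler_sumr sum_delta // nu1.
    by rewrite addrC subrK scalerA mulVf ?scale1r // gt_eqF.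
  - rewrite /mu -mulr_sumr big_split /= -mulr_sumr sum_delta1 // nu2 mulr1.
    by rewrite addrC mulVf // gt_eqF.
  - move=> a aL; apply: mulr_ge0; first by rewrite invr_ge0 ltW.
    by rewrite addr_ge0 ?nu3 // mulr_ge0 // ltW.
apply: lt_le_trans (opt _ mu_feas); rewrite /mu eqxx mulr1.
by rewrite mulr_gt0 ?invr_gt0 // ltr_wpDr // nu3.
Qed.

Lemma scaled_below (s : seq 'X_{1..n}) (mu la : 'X_{1..n} -> R) :
  (forall a, a \in s -> 0 < la a) ->
  exists2 e : R, 0 < e & forall a, a \in s -> e * `|mu a| <= la a.
Proof.
elim: s => [|a s IH] la0; first by exists 1.
have [|e e0 He] := IH; first by move=> x xs; apply: la0; rewrite inE xs orbT.
have m0 : 0 < `|mu a| + 1 by rewrite ltr_wpDl.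
have a0 : 0 < la a by apply: la0; rewrite mem_head.
exists (Num.min e (la a / (`|mu a| + 1))).
  by rewrite lt_min e0 divr_gt0.
move=> x; rewrite inE => /orP[/eqP->|xs]; last first.
  by apply: le_trans (He _ xs); rewrite ler_wpM2r // ge_min lexx.
apply: le_trans (_ : la a / (`|mu a| + 1) * `|mu a| <= _).
  by rewrite ler_wpM2r // ge_min lexx orbT.
by rewrite mulrAC ler_pdivrMr // ler_pM2l // lerDl.
Qed.

(** An affine dependence on the support could be added to and subtracted from
[la], after scaling, without leaving the feasible set. *)
Lemma lp_vertex_aff_indep b la : lp_vertex f b la ->
  aff_indep R [fset a in Lam f | 0 < la a]%fset.
Proof.
move=> [[la1 la2 la3] extr] mu mu0 mu1 a aT.
set T := [fset a in Lam f | 0 < la a]%fset in mu0 mu1 aT.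
have TE x : (x \in T) = (x \in Lam f) && (0 < la x) by rewrite !inE.
pose mu' x := if 0 < la x then mu x else 0.
have sum_mu' (W : nmodType) (v : 'X_{1..n} -> W) :
    \sum_(x <- Lam f) (if 0 < la x then v x else 0) = \sum_(x <- T) v x.
  by rewrite -big_mkcond big_fset_condE.
have s0 : \sum_(x <- Lam f) mu' x = 0 by rewrite sum_mu'.
have s1 : \sum_(x <- Lam f) mu' x *: evec R x = 0.
  rewrite -[RHS]mu1 -sum_mu'; apply: eq_bigr => x _.
  by rewrite /mu'; case: ifP => // _; rewrite scale0r.
have [|e e0 He] := @scaled_below T mu la; first by move=> x; rewrite TE => /andP[].
have feas (c : R) : `|c| = e -> lp_feasible f b (fun x => la x + c * mu' x).
  move=> ce; split.
  - under eq_bigr do rewrite scalerDl -scalerA.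
    by rewrite big_split /= -scaler_sumr s1 scaler0 addr0.
  - by rewrite big_split /= -mulr_sumr s0 mulr0 addr0.
  - move=> x xL; rewrite /mu'; case: ifPn => [x0|_]; last by rewrite mulr0 addr0 la3.
    have := He x; rewrite TE xL x0 => /(_ isT) He'.
    have : - (c * mu x) <= la x.
      by apply: le_trans He'; rewrite -ce -normrM -normrN ler_norm.
    by lra.
move: (aT); rewrite TE => /andP[aL a0].
have : la a + e * mu' a = la a + - e * mu' a.
  apply: (extr _ _ (feas e (gtr0_norm e0)) (feas (- e) _)) aL => //.
    by rewrite normrN gtr0_norm.
  by move=> x _; lra.
rewrite {1 2}/mu' a0 => ea.
have /eqP : e * mu a = 0 by lra.
by rewrite mulf_eq0 gt_eqF //= => /eqP.
Qed.

End Cover.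

(** * Counting the circuits and the triples *)

Section Counting.

Variables (R : realType) (n : nat) (f : {mpoly R[n]}).
Implicit Types (U V T : {fset 'X_{1..n}}) (b : 'X_{1..n}).

Definition indep_circuit (c : {fset 'X_{1..n}} * 'X_{1..n}) : Prop :=
  {subset c.1 <= Lam f} /\ aff_indep R c.1.

Lemma cover_step_indep U V T b : cover_step f U V T b -> indep_circuit (T, b).
Proof.
move=> [_ [a0 _ [_ [la [vert _] ->]]]]; split=> /=; last exact: lp_vertex_aff_indep vert.
by move=> a; rewrite !inE => /andP[].
Qed.

Lemma cover_step_feasible U V T b :
  cover_step f U V T b -> exists la, lp_feasible f b la.
Proof. by move=> [_ [a0 _ [_ [la [[feas _] _] _]]]]; exists la. Qed.

Lemma cover_step_meets U V T b :
  (forall b, b \in Gam f -> exists la, lp_feasible f b la) ->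
  {subset U <= Lam f} -> {subset V <= Gam f} ->
  cover_step f U V T b -> (#|` (U `\` T)%fset| < #|` U|)%N.
Proof.
move=> feas UL VG [bV [a0 a0U [onface [la [_ opt] TE]]]].
have a0T : a0 \in T.
  have := optimal_weight_gt0 feas (VG _ bV) (UL _ a0U) onface opt.
  by rewrite TE !inE /= => ->; rewrite andbT; have := UL _ a0U; rewrite !inE.
apply: fproper_ltn_card; rewrite fproperE fsubsetDl; apply/fsubsetPn.
by exists a0; rewrite // inE a0T.
Qed.

Lemma card_fsetD1_mem V b : b \in V -> #|` V| = #|` (V `\ b)%fset|.+1.
Proof. by move=> bV; rewrite (cardfsD1 b) bV. Qed.

Lemma cover_V_spec U V cs : cover_V f U V cs ->
  size cs = #|` V| /\ forall c, c \in cs -> indep_circuit c.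
Proof.
elim=> [W|{}U {}V T b {}cs V0 U' step _ [IH1 IH2]]; first by rewrite cardfs0.
split; first by rewrite (card_fsetD1_mem (proj1 step)) /= IH1.
by move=> c; rewrite inE => /orP[/eqP->|/IH2//]; exact: cover_step_indep step.
Qed.

Lemma cover_U_spec U V cs : cover_U f U V cs ->
  (forall b, b \in Gam f -> exists la, lp_feasible f b la) ->
  {subset U <= Lam f} -> {subset V <= Gam f} ->
  (size cs <= #|` U|)%N /\ forall c, c \in cs -> indep_circuit c.
Proof.
move=> + feas; elim=> [W _ _|{}U {}V T b {}cs U0 V' step _ IH UL VG]; first by [].
have V'G : {subset V' <= Gam f} by move=> x; rewrite /V'; case: ifP => // _; exact: VG.
have [||IH1 IH2] := IH.
- by move=> x; rewrite inE => /andP[_ /UL].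
- by move=> x; rewrite inE => /andP[_ /V'G].
split; first exact: leq_ltn_trans IH1 (cover_step_meets feas UL V'G step).
by move=> c; rewrite inE => /orP[/eqP->|/IH2//]; exact: cover_step_indep step.
Qed.

(** An exponent of [Gam f] leaves [V] only as the target of a step, where the
linear program was feasible; this invariant is what the loop on [U] needs when
it starts with an empty [V]. *)
Lemma cover_main_spec U V cs : cover_main f U V cs ->
  (forall b, b \in Gam f -> b \notin V -> exists la, lp_feasible f b la) ->
  {subset U <= Lam f} -> {subset V <= Gam f} ->
  (size cs <= #|` U| + #|` V|)%N /\ forall c, c \in cs -> indep_circuit c.
Proof.
elim=> [{}U {}V T b {}cs U0 V0 step _ IH feas UL VG
       |{}V {}cs V0 /cover_V_spec[-> ?] _ _ _|{}U {}cs covU feas UL VG].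
- have [|||IH1 IH2] := IH.
  + move=> c cG; rewrite !inE negb_and negbK => /orP[/eqP->|cV].
      exact: cover_step_feasible step.
    exact: feas.
  + by move=> x; rewrite inE => /andP[_ /UL].
  + by move=> x; rewrite inE => /andP[_ /VG].
  split; last first.
    by move=> c; rewrite inE => /orP[/eqP->|/IH2//]; exact: cover_step_indep step.
  rewrite (card_fsetD1_mem (proj1 step)) /= addnS ltnS (leq_trans IH1) // leq_add2r.
  by apply: fsubset_leq_card; exact: fsubsetDl.
- by rewrite cardfs0 add0n.
- rewrite cardfs0 addn0; apply: cover_U_spec covU _ UL VG => b bG.
  by apply: feas => //; rewrite inE.
Qed.

Lemma simplex_cover_spec cs : simplex_cover f cs ->
  (size cs <= size (msupp f))%N /\ forall c, c \in cs -> indep_circuit c.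
Proof.
move=> /cover_main_spec spec.
have [|//|//|sz ind] := spec; first by move=> b ->.
split=> //; apply: leq_trans sz _; rewrite -size_cat; apply: uniq_leq_size.
  rewrite cat_uniq !fset_uniq andbT; apply/hasPn => b.
  by rewrite /= in_Gam => /andP[].
move=> b; rewrite mem_cat in_Gam => /orP[|/andP[]//].
by rewrite !inE /= => /andP[].
Qed.

End Counting.

Lemma card_socp_triples (R : realType) (n d : nat) (f : {mpoly R[n]})
    (Ss : seq {fset 'rV[rat]_n * 'rV[rat]_n * 'rV[rat]_n}) :
  (0 < d)%N -> (msize f <= d.+1)%N -> socp_triples f Ss ->
  (\sum_(S <- Ss) #|` S|%fset)%N%:R <=
    (size (msupp f))%:R * (n%:R * medseq_bound R (d ^ n.+1)).
Proof.
move=> d0 fd [cs cover [sz med]].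
have [len ind] := simplex_cover_spec cover.
have b0 : 0 <= n%:R * medseq_bound R (d ^ n.+1).
  by rewrite mulr_ge0 // divr_ge0 // sqr_ge0.
apply: (@le_trans _ _ ((size Ss)%:R * (n%:R * medseq_bound R (d ^ n.+1)))); last first.
  by rewrite ler_wpM2r // ler_nat sz.
rewrite (big_nth fset0) natr_sum big_mkord mulr_natl -[in leRHS](card_ord (size Ss)) -sumr_const.
apply: ler_sum => k _; have kcs : (k < size cs)%N by rewrite -sz.
have [TL indT] := ind _ (mem_nth (fset0, 0%MM) kcs).
apply: card_medset indT (med _ kcs) => // a /TL.
rewrite !inE /= => /andP[/msize_mdeg_lt af _].
by rewrite -ltnS (leq_trans af).
Qed.

(** * The soft bound *)

(** Homogenization embeds the monomials of degree at most [d] in [n] variables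
into those of degree exactly [d] in [n.+1] variables, which are counted by
[size_basis]. *)
Lemma card_msupp_le (R : nzRingType) (n d : nat) (f : {mpoly R[n]}) :
  (msize f <= d.+1)%N -> (size (msupp f) <= 'C(d + n, d))%N.
Proof.
move=> fd.
have md a : a \in msupp f -> (mdeg a <= d)%N.
  by move=> /msize_mdeg_lt af; rewrite -ltnS (leq_trans af).
pose h (a : 'X_{1..n}) : 'X_{1..n.+1} := [multinom `|homogenized d a k|%N | k < n.+1].
have hr a i : h a (rshift 1 i) = a i by rewrite mnmE homogenized_r.
have h_inj : injective h.
  by move=> a1 a2 e; apply/mnmP => i; rewrite -!hr e.
have hd a : a \in msupp f -> mdeg (h a) = d.
  move=> /md ad; rewrite mdegE (@big_split_ord _ _ _ 1 n) /= big_ord1.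
  rewrite (eq_bigr _ (fun i _ => hr a i)) -mdegE mnmE homogenized_l subzn //.
  by rewrite absz_nat subnK.
rewrite -(size_map h) -size_basis; apply: uniq_leq_size.
  by rewrite map_inj_uniq // msupp_uniq.
by move=> _ /mapP[a /hd ad ->]; rewrite -basis_cover ad.
Qed.

(** Increasing [n] to [n.+1] multiplies the binomial by [(d + n.+1) / n.+1], which
is at most [d] as soon as [n > 0]; the factor [2] pays for the case [n = 1]. *)
Lemma bin_le_double_exp (n d : nat) : (0 < n)%N -> (2 <= d)%N ->
  ('C(d + n, d) <= 2 * d ^ n)%N.
Proof.
case: n => // n _ d2; elim: n => [|n IH].
  by rewrite addn1 binSn expn1; lia.
have := mul_bin_down (d + n.+2) d.
rewrite addKn addnS /= => E.
rewrite -(leq_pmul2l (ltn0Sn n.+1)) -E.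
apply: (@leq_trans ((d * n.+2) * (2 * d ^ n.+1))).
  by apply: leq_mul => //; nia.
by rewrite [(d ^ n.+2)%N]expnS; move: (d ^ n.+1)%N => x; lia.
Qed.

Lemma degree_ge2_nonconst (R : nzRingType) (n : nat) (f : {mpoly R[n]}) :
  (2 <= (msize f).-1)%N -> (0 < n)%N /\ (0 < size (msupp f))%N.
Proof.
move=> fd.
have f0 : f != 0 by apply: contraTneq fd => ->; rewrite msize0.
split; last by case: (msupp f) (mlead_supp f0).
case: n f fd f0 => // f fd f0; move: fd; rewrite -(mlead_deg f0) /=.
by rewrite mdegE big_ord0.
Qed.

Definition socp_bound (R : realType) (n d t : nat) : R :=
  1 / 8 * t%:R * n%:R * ((n.+1)%:R * log2 (1 + n%:R * d%:R ^+ 2) + 3) ^+ 2.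

(** Strictness comes from [d ^ 2 < 1 + n d ^ 2]. *)
Lemma lt_socp_bound (R : realType) (n d t : nat) :
  (0 < n)%N -> (0 < d)%N -> (0 < t)%N ->
  t%:R * (n%:R * medseq_bound R (d ^ n.+1)) < socp_bound R n d t.
Proof.
move=> n0 d0 t0; rewrite /socp_bound /medseq_bound natrX log2X ?ltr0n //.
have l0 : 0 <= log2 d%:R :> R by apply: log2_ge0; rewrite ler1n.
have ll : 2 * log2 d%:R < log2 (1 + n%:R * d%:R ^+ 2) :> R.
  rewrite -(log2X 2) ?ltr0n //; apply: log2_lt; first by rewrite exprn_gt0 // ltr0n.
  by rewrite ltr_pwDl // ler_peMl ?sqr_ge0 // ler1n.
set X := n.+1%:R * log2 (1 + _) + 3.
have XX : 2 * (n.+1%:R * log2 d%:R) + 3 < X.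
  by rewrite /X ltrD2r mulrCA ltr_pM2l // ltr0n.
have Y0 : 0 <= n.+1%:R * log2 d%:R :> R by rewrite mulr_ge0.
have -> : 1 / 8 * t%:R * n%:R * X ^+ 2 = t%:R * (n%:R * (X ^+ 2 / 8)) by lra.
rewrite !ltr_pM2l ?ltr0n //; nra.
Qed.

Lemma socp_bound_soft (R : realType) (n d t : nat) :
  (0 < n)%N -> (2 <= d)%N -> (t <= 2 * d ^ n)%N ->
  let h : R := d%:R ^+ n * n%:R ^+ 3 in
  socp_bound R n d t <= 81 / 4 * (h * log2 h ^+ 2) /\ 1 <= log2 h.
Proof.
move=> n0 d2 td h.
have d0 : 0 < d%:R :> R by rewrite ltr0n; lia.
have n0' : 0 < n%:R :> R by rewrite ltr0n.
have n1 : 1 <= n%:R :> R by rewrite ler1n.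
have lh : log2 h = n%:R * log2 d%:R + 3 * log2 n%:R.
  by rewrite /h log2M ?exprn_gt0 // !log2X.
have ld : 1 <= log2 d%:R :> R by exact: (@log2_ge_nat R 1 d d2).
have ln : 0 <= log2 n%:R :> R by apply: log2_ge0.
have ldh : log2 d%:R + 3 * log2 n%:R <= log2 h.
  by rewrite lh lerD2r ler_peMl // (le_trans ler01).
have h1 : 1 <= log2 h by lra.
split=> //.
have L : log2 (1 + n%:R * d%:R ^+ 2) <= 3 * log2 h.
  apply: le_trans (_ : log2 (2 * (n%:R * d%:R ^+ 2)) <= _); last first.
    by rewrite !log2M ?mulr_gt0 ?exprn_gt0 // log2X // log2_2; lra.
  apply: log2_le; first by rewrite ltr_wpDr // mulr_ge0 // ?sqr_ge0 // ltW.
  have : 1 <= n%:R * d%:R ^+ 2 :> R.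
    by rewrite -natrX -natrM ler1n muln_gt0 n0 expn_gt0; lia.
  lra.
have L0 : 0 <= log2 (1 + n%:R * d%:R ^+ 2) :> R.
  by apply: log2_ge0; rewrite lerDl mulr_ge0 // ?sqr_ge0 // ltW.
rewrite /socp_bound; set X := _ * log2 _ + 3.
have X0 : 0 <= X by rewrite /X addr_ge0 // mulr_ge0.
have X9 : X <= 9 * n%:R * log2 h.
  have e1 : n.+1%:R * log2 (1 + n%:R * d%:R ^+ 2) <= 2 * n%:R * (3 * log2 h).
    apply: ler_pM => //.
    by rewrite -natrM ler_nat; clear -n0; lia.
  have e2 : 1 <= n%:R * log2 h by rewrite -[leLHS]mulr1 ler_pM.
  rewrite /X; lra.
have XX : X ^+ 2 <= (9 * n%:R * log2 h) ^+ 2 by rewrite ler_sqr ?nnegrE // (le_trans X0).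
have tR : t%:R <= 2 * d%:R ^+ n :> R by rewrite -natrX -natrM ler_nat.
apply: le_trans (_ : 1 / 8 * (2 * d%:R ^+ n) * n%:R * (9 * n%:R * log2 h) ^+ 2 <= _).
  apply: ler_pM => //; first by rewrite !mulr_ge0 // invr_ge0.
    exact: sqr_ge0.
  by rewrite ler_pM2r // ler_pM2l ?tR //; lra.
rewrite {2}/h; lra.
Qed.

(** For an integer [h > 2], [log2 h >= log2 3 > 3 / 2], and [(3 / 2) ^ 8] exceeds
the constant [81 / 4] of [socp_bound_soft]. *)
Lemma log2_absorbs (R : realType) (h : nat) : (2 < h)%N ->
  81 / 4 <= log2 h%:R ^+ 8 :> R.
Proof.
move=> h3; have l3 : 3 / 2 <= log2 h%:R :> R.
  have : 3%:R <= log2 (h ^ 2)%N%:R :> R.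
    by apply: log2_ge_nat; rewrite (@leq_trans (3 ^ 2)) // leq_exp2r.
  by rewrite natrX log2X ?ltr0n; [lra | lia].
apply: le_trans (_ : (3 / 2) ^+ 8 <= _); first by lra.
by rewrite lerXn2r ?nnegrE //; lra.
Qed.

Theorem lemma29 (R : realType) :
  let bound (n d t : nat) : R :=
    1 / 8 * t%:R * n%:R *
      ((n.+1)%:R * log2 (1 + n%:R * d%:R ^+ 2) + 3) ^+ 2 in
  (forall (n d t : nat) (f : {mpoly rat[n]})
     (Ss : seq {fset 'rV[rat]_n * 'rV[rat]_n * 'rV[rat]_n}),
     sonc_instance R d t f ->
     socp_triples (map_mpoly (@ratr R) f) Ss ->
     (\sum_(S <- Ss) #|` S|%fset)%N%:R < bound n d t)
  /\
  softO
    (fun '(n, d, t) => exists f : {mpoly rat[n]}, sonc_instance R d t f)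
    (fun '(n, d, t) => bound n d t)
    (fun '(n, d, t) => d%:R ^+ n * n%:R ^+ 3).
Proof.
move=> bound; split.
  move=> n d t f Ss [[fd d2 ft] _ _ _ _] triples.
  have [n0 t0] : (0 < n)%N /\ (0 < t)%N.
    by rewrite -ft; apply: degree_ge2_nonconst; rewrite fd.
  have pF : perm_eq (msupp (map_mpoly (@ratr R) f)) (msupp f).
    exact: msupp_map_mpoly (fmorph_inj _).
  have msF : (msize (map_mpoly (@ratr R) f) <= d.+1)%N.
    by rewrite msizeE (perm_big _ pF) -msizeE; lia.
  apply: le_lt_trans (card_socp_triples _ msF triples) _; first by lia.
  by rewrite (perm_size pF) ft; apply: lt_socp_bound; lia.
exists 10%N, 21%N => -[[n d] t] [f [[fd d2 ft] _ _ _ _]].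
have [n0 t0] : (0 < n)%N /\ (0 < t)%N.
  by rewrite -ft; apply: degree_ge2_nonconst; rewrite fd.
have td : (t <= 2 * d ^ n)%N.
  rewrite -ft; apply: leq_trans (bin_le_double_exp n0 d2).
  by apply: card_msupp_le; lia.
have [le_h h1] := @socp_bound_soft R n d t n0 d2 td.
rewrite -/(socp_bound R n d t).
set h := d%:R ^+ n * n%:R ^+ 3 in le_h h1 *.
have h0 : 0 <= h by rewrite mulr_ge0 // exprn_ge0.
have hl : 0 <= h * log2 h ^+ 2 by rewrite mulr_ge0 // sqr_ge0.
have -> : log2 h ^+ 10 = log2 h ^+ 8 * log2 h ^+ 2 by rewrite -exprD.
split=> [h2|]; apply: le_trans le_h _.
  rewrite [leRHS]mulrCA ler_wpM2r //.
  have hN : h = (d ^ n * n ^ 3)%N%:R by rewrite natrM !natrX.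
  by rewrite hN log2_absorbs // -(ltr_nat R) -hN.
rewrite -[leRHS]mulrA [h * (_ ^+ 8 * _)]mulrCA; apply: ler_pM => //.
- by lra.
- by lra.
- by rewrite ler_peMl // exprn_ege1.
Qed.
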